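(* Let $A$ be a commutative ring with unit whose elements are enumerated as $x_0, x_1, x_2, \ldots$ (a surjection $\mathbb{N} \to A$, $n \mapsto x_n$). Define ideals $\mathfrak{m}_n \subseteq A$ recursively by $\mathfrak{m}_0 := \{0\}$ and $\mathfrak{m}_{n+1} := \mathfrak{m}_n + (\{x_n \mid 1 \notin \mathfrak{m}_n + (x_n)\})$, and set $\mathfrak{m} := \bigcup_{n} \mathfrak{m}_n$. Assume that for every finitely generated ideal $\mathfrak{a} \subseteq A$ we have $1 \notin \mathfrak{a}$ or $\neg(1 \notin \mathfrak{a})$. Then: (a) Each ideal $\mathfrak{m}_n$ is finitely generated. (b) The ideal $\mathfrak{m}$ is detachable. If even $1 \in \mathfrak{a}$ or $1 \notin \mathfrak{a}$ for every finitely generated ideal $\mathfrak{a} \subseteq A$, then: (c) The ideal $\mathfrak{m}$ is maximal in the strong sense that for every element $x \in A$, $x \in \mathfrak{m}$ or $1 \in \mathfrak{m} + (x)$, which is to say that the quotient ring $A/\mathfrak{m}$ is a geometric field (every element is zero or invertible).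
   Context: The metatheory is constructive (minimal logic; no law of excluded middle and no form of the axiom of choice). The negation ``not $\varphi$'' (written $\neg\varphi$) means ``$\varphi \Rightarrow 1 = 0$ in $A$''; consequently $x \notin M$ means $x \in M \Rightarrow 1 = 0$ in $A$. A subset $M \subseteq A$ is detachable if for all $x \in A$, either $x \in M$ or $x \notin M$ (with this meaning of $\notin$). The ring $A$ is not assumed to be nontrivial or to have decidable equality. For an arbitrary (not necessarily detachable) subset $M \subseteq A$, $(M)$ denotes the ideal generated by $M$, i.e. $(M) = \{\sum_{i=1}^k a_i v_i \mid k \geq 0,\ a_i \in A,\ v_i \in M\}$, and $(x) = (\{x\})$. The set $\{x_n \mid 1 \notin \mathfrak{m}_n + (x_n)\}$ is the subset of the singleton $\{x_n\}$ which contains $x_n$ if and only if $1 \notin \mathfrak{m}_n + (x_n)$. *)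

(* Defs.v *)
From Stdlib Require Import PeanoNat.
From Stdlib Require Export List SetoidList Cring.

(* Everything is stated in Prop, with [Prop] disjunction and existence, so that
   neither excluded middle nor choice is built into the notions below.  A ring
   is a setoid carrying the operations of [Ncring] and the axioms of [Cring]:
   its equality is an arbitrary equivalence relation, neither decidable nor
   assumed to satisfy [~ (1 == 0)], and quotients are available. *)
Record comRing := ComRing {
  carrier :> Type;
  comRing_zero : carrier;
  comRing_one : carrier;
  comRing_add : carrier -> carrier -> carrier;
  comRing_mul : carrier -> carrier -> carrier;
  comRing_sub : carrier -> carrier -> carrier;
  comRing_opp : carrier -> carrier;
  comRing_eq : carrier -> carrier -> Prop;
  comRing_ops : @Ring_ops carrier comRing_zero comRing_one comRing_add
                  comRing_mul comRing_sub comRing_opp comRing_eq;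
  comRing_ring : Ring (Ro := comRing_ops);
  comRing_cring : Cring (Rr := comRing_ring)
}.

#[global] Existing Instance comRing_ops.
#[global] Existing Instance comRing_ring.
#[global] Existing Instance comRing_cring.

(* Negation of minimal logic: absurdity is [1 == 0] in A, not [False]. *)
Definition neg (A : comRing) (P : Prop) : Prop := P -> (1 : A) == 0.

Definition detachable {A : comRing} (M : A -> Prop) : Prop :=
  forall x : A, M x \/ neg A (M x).

Record ideal (A : comRing) := Ideal {
  ideal_mem :> A -> Prop;
  ideal_eq : forall x y : A, x == y -> ideal_mem x -> ideal_mem y;
  ideal_zero : ideal_mem 0;
  ideal_plus : forall x y : A, ideal_mem x -> ideal_mem y -> ideal_mem (x + y);
  ideal_mult : forall a x : A, ideal_mem x -> ideal_mem (a * x)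
}.
Arguments ideal_mem {A} i _.
Arguments ideal_eq {A} i x y _ _.
Arguments ideal_zero {A} i.
Arguments ideal_plus {A} i x y _ _.
Arguments ideal_mult {A} i a x _.

Definition lincomb {A : comRing} (l : list (A * A)) : A :=
  fold_right (fun (p : A * A) (s : A) => fst p * snd p + s) 0 l.

Lemma lincomb_app (A : comRing) (l l' : list (A * A)) :
  lincomb (l ++ l') == lincomb l + lincomb l'.
Proof.
induction l as [|p l IH]; simpl.
- cring.
- fold (lincomb (l ++ l')) (lincomb l). rewrite IH. cring.
Qed.

Lemma lincomb_scale (A : comRing) (a : A) (l : list (A * A)) :
  lincomb (map (fun p => (a * fst p, snd p)) l) == a * lincomb l.
Proof.
induction l as [|p l IH]; simpl.
- cring.
- fold (lincomb (map (fun p => (a * fst p, snd p)) l)) (lincomb l).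
  rewrite IH. cring.
Qed.

Definition generated {A : comRing} (M : A -> Prop) : ideal A.
Proof.
refine (@Ideal A
  (fun x => exists l : list (A * A),
     Forall (fun p => M (snd p)) l /\ x == lincomb l) _ _ _ _).
- intros x y xy [l [Ml xl]]. exists l. split; [exact Ml|].
  rewrite <- xy. exact xl.
- exists nil. split; [constructor|reflexivity].
- intros x y [l [Ml xl]] [l' [Ml' yl']]. exists (l ++ l'). split.
  + apply Forall_app. split; assumption.
  + rewrite lincomb_app, xl, yl'. reflexivity.
- intros a x [l [Ml xl]]. exists (map (fun p => (a * fst p, snd p)) l). split.
  + apply Forall_map. exact Ml.
  + rewrite lincomb_scale, xl. reflexivity.
Defined.

Definition singleton {A : comRing} (x : A) : A -> Prop := fun y => y == x.

Definition principal {A : comRing} (x : A) : ideal A := generated (singleton x).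

Definition finitely_generated {A : comRing} (I : ideal A) : Prop :=
  exists l : list A,
    forall x : A, I x <-> generated (fun y => InA (_==_) y l) x.

Definition zero_ideal (A : comRing) : ideal A.
Proof.
refine (@Ideal A (singleton 0) _ _ _ _); unfold singleton.
- intros x y xy x0. rewrite <- xy. exact x0.
- reflexivity.
- intros x y x0 y0. rewrite x0, y0. cring.
- intros a x x0. rewrite x0. cring.
Defined.

Definition ideal_sum {A : comRing} (I J : ideal A) : ideal A.
Proof.
refine (@Ideal A
  (fun x => exists i j : A, I i /\ J j /\ x == i + j) _ _ _ _).
- intros x y xy (i & j & Ii & Jj & xij). exists i, j.
  repeat split; [exact Ii|exact Jj|]. rewrite <- xy. exact xij.
- exists 0, 0. repeat split; [apply ideal_zero|apply ideal_zero|cring].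
- intros x y (i & j & Ii & Jj & xij) (i' & j' & Ii' & Jj' & yij').
  exists (i + i'), (j + j').
  repeat split; [apply ideal_plus; assumption|apply ideal_plus; assumption|].
  rewrite xij, yij'. cring.
- intros a x (i & j & Ii & Jj & xij). exists (a * i), (a * j).
  repeat split; [apply ideal_mult; assumption|apply ideal_mult; assumption|].
  rewrite xij. cring.
Defined.

Fixpoint m_seq {A : comRing} (x : nat -> A) (n : nat) : ideal A :=
  match n with
  | O => zero_ideal A
  | S n' =>
      ideal_sum (m_seq x n')
        (generated (fun y : A =>
           singleton (x n') y /\
           neg A (ideal_sum (m_seq x n') (principal (x n')) 1)))
  end.

Lemma m_seq_le (A : comRing) (x : nat -> A) (n k : nat) (y : A) :
  n <= k -> m_seq x n y -> m_seq x k y.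
Proof.
intros nk ny. induction nk as [|k _ IH]; [exact ny|].
exists y, 0. repeat split; [exact IH|apply ideal_zero|cring].
Qed.

Definition m_lim {A : comRing} (x : nat -> A) : ideal A.
Proof.
refine (@Ideal A (fun y => exists n : nat, m_seq x n y) _ _ _ _).
- intros y z yz [n ny]. exists n. exact (ideal_eq _ y z yz ny).
- exists O. apply ideal_zero.
- intros y z [n ny] [k kz]. exists (Nat.max n k). apply ideal_plus.
  + exact (m_seq_le _ _ _ _ _ (Nat.le_max_l n k) ny).
  + exact (m_seq_le _ _ _ _ _ (Nat.le_max_r n k) kz).
- intros a y [n ny]. exists n. apply ideal_mult. exact ny.
Defined.

Section Quotient.
Context (A : comRing) (I : ideal A).

Definition quotient_eq (x y : A) : Prop := I (x - y).

Definition quotient_ops :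
  @Ring_ops A 0 1 (_+_) (_*_) (_-_) (-_) quotient_eq :=
  @Build_Ring_ops _ _ _ _ _ _ _ _.

Lemma quotient_eq_refines (x y : A) :
  x == y -> quotient_eq x y.
Proof.
intros xy. apply (ideal_eq I 0); [|apply ideal_zero].
rewrite xy. cring.
Qed.

Lemma quotient_ring : Ring (Ro := quotient_ops).
Proof.
constructor; try (intros; apply quotient_eq_refines; cring).
- constructor.
  + intros x. apply quotient_eq_refines. reflexivity.
  + intros x y xy. apply (ideal_eq I ((- (1)) * (x - y))); [cring|].
    apply ideal_mult. exact xy.
  + intros x y z xy yz. apply (ideal_eq I ((x - y) + (y - z))); [cring|].
    apply ideal_plus; assumption.
- intros x x' xx' y y' yy'.
  apply (ideal_eq I ((x - x') + (y - y'))); [cring|].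
  apply ideal_plus; assumption.
- intros x x' xx' y y' yy'.
  apply (ideal_eq I (y * (x - x') + x' * (y - y'))); [cring|].
  apply ideal_plus; apply ideal_mult; assumption.
- intros x x' xx' y y' yy'.
  apply (ideal_eq I ((x - x') + (- (1)) * (y - y'))); [cring|].
  apply ideal_plus; [|apply ideal_mult]; assumption.
- intros x x' xx'.
  apply (ideal_eq I ((- (1)) * (x - x'))); [cring|].
  apply ideal_mult. assumption.
Qed.

Lemma quotient_cring : Cring (Rr := quotient_ring).
Proof. intros x y. apply quotient_eq_refines. cring. Qed.

Definition quotient : comRing :=
  ComRing A 0 1 (_+_) (_*_) (_-_) (-_) quotient_eq
    quotient_ops quotient_ring quotient_cring.
End Quotient.
Arguments quotient {A} I.

Definition geometric_field (K : comRing) : Prop :=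
  forall x : K, x == 0 \/ exists y : K, x * y == 1.

(* Main.v *)
(* Each [m_seq x n] is proper in the sense of [neg]: an element [x n] is only
   adjoined when this keeps the ideal proper, and if nothing is adjoined the
   ideal does not change.  Hence so is [m_lim x].  Knowing whether
   [m_seq x n + (x n)] is proper decides whether [x n] is adjoined; and if [x n]
   lies in [m_lim x] at all, then [m_seq x n + (x n)], being contained in
   [m_lim x], is proper, so [x n] is adjoined at stage [n]. *)
Require Import Defs.

(** Ex falso for [neg]: minimal absurdity still yields every ideal membership, since
    [a == a * 1 == a * 0]. *)
Lemma ideal_trivial {A : comRing} (I : ideal A) (a : A) : (1 : A) == 0 -> I a.
Proof.
intros e. apply (ideal_eq I 0); [|apply ideal_zero].
transitivity (a * 0); [cring|]. rewrite <- e. cring.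
Qed.

Lemma generated_sub {A : comRing} (M : A -> Prop) (I : ideal A) :
  (forall a, M a -> I a) -> forall a, generated M a -> I a.
Proof.
intros MI a [l [Ml al]]. apply (ideal_eq I (lincomb l)); [symmetry; exact al|].
clear a al. induction Ml as [|p l Mp _ IH]; simpl.
- apply ideal_zero.
- apply ideal_plus; [apply ideal_mult, MI, Mp | exact IH].
Qed.

Lemma generated_mem {A : comRing} (M : A -> Prop) (a : A) :
  M a -> generated M a.
Proof.
intros Ma. exists ((1, a) :: nil). split.
- constructor; [exact Ma | constructor].
- simpl. cring.
Qed.

(** A linear combination is empty or exhibits a generator. For the conditional singleton in [m_seq],
    a generator carries a proof of the condition, which is thus recovered without being decided. *)
Lemma generated_zero_or_inhabited {A : comRing} (M : A -> Prop) (a : A) :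
  generated M a -> a == 0 \/ exists v, M v.
Proof.
intros [l [Ml al]]. destruct Ml as [|p l Mp _].
- left. exact al.
- right. exists (snd p). exact Mp.
Qed.

(** All generators used equal [a], so [a] factors out and the coefficients add up. *)
Lemma principal_multiple {A : comRing} (a b : A) :
  principal a b -> exists c, b == a * c.
Proof.
intros [l [Ml bl]]. revert b bl.
induction Ml as [|p l Mp _ IH]; simpl; intros b bl.
- exists 0. rewrite bl. cring.
- destruct (IH _ (reflexivity _)) as [c lc]. exists (fst p + c).
  fold (lincomb l) in bl. red in Mp. rewrite bl, lc, Mp. cring.
Qed.

Lemma ideal_sum_l {A : comRing} (I J : ideal A) (a : A) :
  I a -> ideal_sum I J a.
Proof.
intros Ia. exists a, 0. repeat split; [exact Ia | apply ideal_zero | cring].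
Qed.

Lemma ideal_sum_r {A : comRing} (I J : ideal A) (a : A) :
  J a -> ideal_sum I J a.
Proof.
intros Ja. exists 0, a. repeat split; [apply ideal_zero | exact Ja | cring].
Qed.

Lemma ideal_sum_sub {A : comRing} (I J K : ideal A) :
  (forall a, I a -> K a) -> (forall a, J a -> K a) ->
  forall a, ideal_sum I J a -> K a.
Proof.
intros IK JK a (i & j & Ii & Jj & aij).
apply (ideal_eq K (i + j)); [symmetry; exact aij|].
apply ideal_plus; auto.
Qed.

Lemma principal_sub {A : comRing} (b : A) (I : ideal A) :
  I b -> forall a, principal b a -> I a.
Proof.
intros Ib. apply generated_sub. intros c cb.
apply (ideal_eq I b); [symmetry; exact cb | exact Ib].
Qed.

Lemma finitely_generated_ext {A : comRing} (I J : ideal A) :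
  (forall a, I a <-> J a) -> finitely_generated I -> finitely_generated J.
Proof.
intros IJ [l Il]. exists l. intros a. rewrite <- IJ. apply Il.
Qed.

Lemma finitely_generated_zero (A : comRing) :
  finitely_generated (zero_ideal A).
Proof.
exists nil. intros a. split.
- intros a0. apply (ideal_eq _ 0); [symmetry; exact a0 | apply ideal_zero].
- apply generated_sub. intros b b_nil. inversion b_nil.
Qed.

Lemma finitely_generated_add {A : comRing} (I : ideal A) (b : A) :
  finitely_generated I -> finitely_generated (ideal_sum I (principal b)).
Proof.
intros [l Il]. exists (b :: l). intros a. split.
- apply ideal_sum_sub.
  + intros c Ic. apply Il in Ic. revert c Ic. apply generated_sub.
    intros c lc. apply generated_mem. right. exact lc.
  + apply principal_sub, generated_mem. left. reflexivity.
- apply generated_sub. intros c bl. inversion bl as [? ? cb | ? ? lc]; subst.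
  + apply ideal_sum_r, generated_mem. exact cb.
  + apply ideal_sum_l, Il, generated_mem. exact lc.
Qed.

Section Construction.
Context {A : comRing} (x : nat -> A).

Lemma m_seq_proper (n : nat) : neg A (m_seq x n 1).
Proof.
induction n as [|n IH].
- exact (fun e => e).
- intros (i & j & mi & gj & e).
  destruct (generated_zero_or_inhabited _ _ gj) as [j0 | [v [_ proper]]].
  + apply IH, (ideal_eq _ i); [|exact mi]. rewrite e, j0. cring.
  (* Something was adjoined, so [proper] is available, and the decomposition [1 == i + j] itself
     contradicts it. *)
  + apply proper. exists i, j. repeat split; [exact mi | | exact e].
    revert gj. apply generated_sub.
    intros w [wx _]. apply generated_mem. exact wx.
Qed.

Lemma m_lim_proper : neg A (m_lim x 1).
Proof. intros [n mn]. exact (m_seq_proper n mn). Qed.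

Lemma m_seq_succ_add (n : nat) :
  neg A (ideal_sum (m_seq x n) (principal (x n)) 1) ->
  forall a, ideal_sum (m_seq x n) (principal (x n)) a <-> m_seq x (S n) a.
Proof.
intros proper a. split.
- apply ideal_sum_sub.
  + intros b. apply ideal_sum_l.
  + apply principal_sub, ideal_sum_r, generated_mem.
    split; [red; reflexivity | exact proper].
- apply ideal_sum_sub.
  + intros b. apply ideal_sum_l.
  + apply generated_sub. intros b [bx _]. apply ideal_sum_r, generated_mem, bx.
Qed.

(** A generator of the added summand would come with a proof of the refuted condition, hence force
    [1 == 0], where every membership is trivial. *)
Lemma m_seq_succ_same (n : nat) :
  neg A (neg A (ideal_sum (m_seq x n) (principal (x n)) 1)) ->
  forall a, m_seq x n a <-> m_seq x (S n) a.
Proof.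
intros nproper a. split.
- apply ideal_sum_l.
- apply ideal_sum_sub; [auto|].
  apply generated_sub. intros b [_ proper].
  apply ideal_trivial, nproper, proper.
Qed.

Lemma m_lim_adjoined (n : nat) :
  neg A (ideal_sum (m_seq x n) (principal (x n)) 1) -> m_lim x (x n).
Proof.
intros proper. exists (S n). apply m_seq_succ_add; [exact proper|].
apply ideal_sum_r, generated_mem. red. reflexivity.
Qed.

Lemma m_lim_sum_proper (n : nat) :
  m_lim x (x n) -> neg A (ideal_sum (m_seq x n) (principal (x n)) 1).
Proof.
intros mx one. apply m_lim_proper. revert one. apply ideal_sum_sub.
- intros b mb. exists n. exact mb.
- apply principal_sub, mx.
Qed.

Lemma m_seq_finitely_generated :
  (forall I : ideal A, finitely_generated I ->
     neg A (I 1) \/ neg A (neg A (I 1))) ->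
  forall n, finitely_generated (m_seq x n).
Proof.
intros dec n. induction n as [|n IH].
- apply finitely_generated_zero.
- pose proof (finitely_generated_add _ (x n) IH) as fg.
  (* The next ideal is this sum in the first case and [m_seq x n] itself in the second. *)
  destruct (dec _ fg) as [proper | nproper].
  + exact (finitely_generated_ext _ _ (m_seq_succ_add n proper) fg).
  + exact (finitely_generated_ext _ _ (m_seq_succ_same n nproper) IH).
Qed.

End Construction.

Lemma geometric_field_quotient {A : comRing} (I : ideal A) :
  (forall a : A, I a \/ ideal_sum I (principal a) 1) ->
  geometric_field (quotient I).
Proof.
intros max.
(* Quotient equality is unfolded so that [cring] computes in [A]. *)
change (forall a : A, I (a - 0) \/ exists b : A, I (a * b - 1)).
intros a. destruct (max a) as [Ia | (i & j & Ii & aj & e)].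
- left. apply (ideal_eq I a); [cring | exact Ia].
- right. destruct (principal_multiple _ _ aj) as [b jb]. exists b.
  (* From [1 == i + a * b], the difference [a * b - 1] is [- i]. *)
  apply (ideal_eq I (- (1) * i)); [|apply ideal_mult, Ii].
  transitivity (j - (i + j)); [cring|]. rewrite <- e, jb. reflexivity.
Qed.

Theorem proposition1p8 (A : comRing) (x : nat -> A)
  (x_surj : forall a : A, exists n : nat, x n == a) :
  ((forall I : ideal A, finitely_generated I ->
      neg A (I 1) \/ neg A (neg A (I 1))) ->
    (forall n : nat, finitely_generated (m_seq x n)) /\
    detachable (m_lim x)) /\
  ((forall I : ideal A, finitely_generated I -> I 1 \/ neg A (I 1)) ->
    (forall a : A, m_lim x a \/ ideal_sum (m_lim x) (principal a) 1) /\
    geometric_field (quotient (m_lim x))).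
Proof.
split.
- intros dec. pose proof (m_seq_finitely_generated x dec) as fg.
  split; [exact fg|].
  intros a. destruct (x_surj a) as [n xa].
  destruct (dec _ (finitely_generated_add _ (x n) (fg n)))
    as [proper | nproper].
  + left. exact (ideal_eq _ _ _ xa (m_lim_adjoined x n proper)).
  (* Membership of [x n] would make the sum proper, which [nproper] refutes. *)
  + right. intros ma. apply nproper, m_lim_sum_proper.
    apply (ideal_eq _ a); [symmetry; exact xa | exact ma].
- intros dec.
  assert (max : forall a : A,
    m_lim x a \/ ideal_sum (m_lim x) (principal a) 1).
  { assert (fg : forall n, finitely_generated (m_seq x n)).
    (* The stronger alternative implies the weaker one: [I 1] refutes [neg A (I 1)]. *)
    { apply m_seq_finitely_generated. intros I fgI.
      destruct (dec I fgI) as [one | proper]; [right | left; exact proper].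
      intros proper. exact (proper one). }
    intros a. destruct (x_surj a) as [n xa].
    destruct (dec _ (finitely_generated_add _ (x n) (fg n))) as [one | proper].
    (* As [x n == a], the stage-[n] sum containing 1 lies inside the sum of [m_lim x] and
       [principal a]. *)
    - right. revert one. apply ideal_sum_sub.
      + intros b mb. apply ideal_sum_l. exists n. exact mb.
      + apply principal_sub, ideal_sum_r, generated_mem, xa.
    - left. exact (ideal_eq _ _ _ xa (m_lim_adjoined x n proper)). }
  split; [exact max | exact (geometric_field_quotient _ max)].
Qed.
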